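(* Let $E$ and $F$ be preordered topological vector spaces and let $T : E \to F$ be a linear map that is continuous, positive, and injective. If $F$ is semisimple, then so is $E$.
   Context: All vector spaces are real and all topological vector spaces are Hausdorff. A convex cone is a non-empty subset $\mathcal{K}$ with $\mathcal{K}+\mathcal{K}\subseteq\mathcal{K}$ and $\lambda\mathcal{K}\subseteq\mathcal{K}$ for all $\lambda\ge0$. A preordered topological vector space is a topological vector space $E$ equipped with a convex cone $E_+$ (its positive cone). $E'_+$ denotes the set of continuous linear functionals on $E$ that are non-negative on $E_+$. $E$ (or $E_+$) is semisimple if $E'_+$ separates points on $E$, i.e. for every $x\neq0$ there is $\varphi\in E'_+$ with $\varphi(x)\ne0$. A linear map $T:E\to F$ is positive if $T[E_+]\subseteq F_+$. *)

(* Defs.v *)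
From HB Require Import structures.
From mathcomp Require Import all_boot all_order all_algebra.
From mathcomp Require Import all_classical all_reals all_analysis.

Set Implicit Arguments.
Unset Strict Implicit.
Unset Printing Implicit Defensive.

Import Order.TTheory GRing.Theory Num.Theory.
Import numFieldNormedType.Exports.

Local Open Scope classical_set_scope.
Local Open Scope ring_scope.

(* Topological vector spaces are rendered by [topologicalLmodType R]: the
   library's [tvsType R] would add local convexity. *)

Definition convex_cone (R : realType) (E : lmodType R) (K : set E) : Prop :=
  [/\ K !=set0,
      forall x y, K x -> K y -> K (x + y) &
      forall (a : R) x, 0 <= a -> K x -> K (a *: x)].

Definition positive_map (R : realType) (E F : lmodType R)
    (Epos : set E) (Fpos : set F) (T : E -> F) : Prop :=
  T @` Epos `<=` Fpos.

(* The set E'_+ of positive continuous functionals; [R^o] is R as a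
   topological vector space over itself. *)
Definition dual_cone (R : realType) (E : topologicalLmodType R)
    (Epos : set E) : set {linear E -> R^o} :=
  [set phi : {linear E -> R^o} |
    continuous (phi : E -> R^o) /\ forall x, Epos x -> 0 <= phi x :> R].

Definition semisimple (R : realType) (E : topologicalLmodType R)
    (Epos : set E) : Prop :=
  forall x : E, x != 0 -> exists2 phi, dual_cone Epos phi & phi x != 0.

(* Main.v *)
Require Import Defs.
From HB Require Import structures.
From mathcomp Require Import all_boot all_order all_algebra.
From mathcomp Require Import all_classical all_reals all_analysis.

Set Implicit Arguments.
Unset Strict Implicit.
Unset Printing Implicit Defensive.

Import Order.TTheory GRing.Theory Num.Theory.
Import numFieldNormedType.Exports.

Local Open Scope classical_set_scope.
Local Open Scope ring_scope.

(** Positive continuous functionals pull back along [T]: if [psi] lies in the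
    dual cone of [F], then [psi \o T] lies in the dual cone of [E]. Injectivity
    moves a nonzero [x] to a nonzero [T x], and a functional that detects [T x]
    pulls back to one that detects [x]. *)

Lemma dual_cone_comp (R : realType) (E F : topologicalLmodType R)
    (Epos : set E) (Fpos : set F) (T : {linear E -> F})
    (psi : {linear F -> R^o}) :
  continuous T -> positive_map Epos Fpos T -> dual_cone Fpos psi ->
  dual_cone Epos (psi \o T : {linear E -> R^o}).
Proof.
move=> T_cont T_pos [psi_cont psi_ge0]; split=> [x|x Ex].
  by apply: continuous_comp; [exact: T_cont | exact: psi_cont].
by apply: psi_ge0; apply: T_pos; exists x.
Qed.

Theorem proposition6p1 (R : realType) (E F : topologicalLmodType R)
    (hE : hausdorff_space E) (hF : hausdorff_space F)
    (Epos : set E) (Fpos : set F)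
    (Epos_cone : convex_cone Epos) (Fpos_cone : convex_cone Fpos)
    (T : {linear E -> F}) (T_cont : continuous T)
    (T_pos : positive_map Epos Fpos T) (T_inj : injective T) :
  semisimple Fpos -> semisimple Epos.
Proof.
move=> F_semisimple x x_neq0.
have Tx_neq0 : T x != 0.
  by apply: contra_neq x_neq0 => Tx0; apply: T_inj; rewrite Tx0 linear0.
have [psi psi_dual psiTx_neq0] := F_semisimple _ Tx_neq0.
exists (psi \o T : {linear E -> R^o}) => //.
exact: dual_cone_comp T_cont T_pos psi_dual.
Qed.
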